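(* Let $k_0\ge k_1\ge1$ and $l_0\ge l_1\ge1$ be integers and let $F=x_0^{k_0}x_1^{k_1}y_0^{l_0}y_1^{l_1}$. Let $\mathrm{r}(F)$ be the rank of $F$ with respect to $\mathbb{P}^1\times\mathbb{P}^1$ embedded by the complete linear system $|\mathcal{O}(k_0+k_1,l_0+l_1)|$. The following inequalities hold: (i) $\mathrm{r}(F)\le(k_0+1)(l_1+1)+(k_1+1)(l_0+1)-(k_1+1)(l_1+1)$; (ii) $\mathrm{r}(F)\ge(k_0+1)(l_1+1)$ if $k_0>k_1$, and $\mathrm{r}(F)\ge(k_1+1)(l_0+1)$ if $l_0>l_1$; (iii) $\mathrm{r}(F)\ge(k_1+2)(l_1+2)-1$ if $k_0>k_1$ and $l_0>l_1$.
   Context: Everything is over $\mathbb{C}$. Put $a=k_0+k_1$, $b=l_0+l_1$. The space $H^0(\mathbb{P}^1\times\mathbb{P}^1,\mathcal{O}(a,b))$ is the space of bihomogeneous polynomials of bidegree $(a,b)$ in $\alpha_0,\alpha_1$ (bidegree $(1,0)$) and $\beta_0,\beta_1$ (bidegree $(0,1)$). Its dual is identified with the space $T_{(a,b)}$ of bihomogeneous polynomials of bidegree $(a,b)$ in variables $x_0,x_1;y_0,y_1$, in such a way that the monomials $x_0^{a_0}x_1^{a_1}y_0^{b_0}y_1^{b_1}$ form the basis dual to the monomials $\alpha_0^{a_0}\alpha_1^{a_1}\beta_0^{b_0}\beta_1^{b_1}$. Under this identification the embedding $\mathbb{P}^1\times\mathbb{P}^1\hookrightarrow\mathbb{P}(T_{(a,b)})$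 is $$([\lambda_0,\lambda_1],[\mu_0,\mu_1])\mapsto\Big[\sum_{a_0+a_1=a,\ b_0+b_1=b}\lambda_0^{a_0}\lambda_1^{a_1}\mu_0^{b_0}\mu_1^{b_1}\,x_0^{a_0}x_1^{a_1}y_0^{b_0}y_1^{b_1}\Big].$$ The rank $\mathrm{r}(F)$ is the least integer $s\ge1$ such that $[F]$ lies in the projective linear span of some $s$ points of the image of this embedding. *)

(* Defs.v *)
From mathcomp Require Import all_boot all_order all_algebra.
From mathcomp Require Import reals.
From mathcomp Require Import complex.
From mathcomp Require Import mpoly.

Set Implicit Arguments.
Unset Strict Implicit.
Unset Printing Implicit Defensive.

Import Order.TTheory GRing.Theory Num.Theory.

Local Open Scope ring_scope.

(* The variables x_0, x_1, y_0, y_1 are 'X_0, ..., 'X_3. *)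
Definition bimonom (K : fieldType) (p q r s : nat) : {mpoly K[4]} :=
  'X_(inord 0) ^+ p * 'X_(inord 1) ^+ q * 'X_(inord 2) ^+ r * 'X_(inord 3) ^+ s.

(* A point of P^1 is represented by a nonzero vector of homogeneous coordinates;
   the value is a representative in T_(a, b) of the image of ([l], [m]). *)
Definition segre_veronese (K : fieldType) (a b : nat) (l m : 'rV[K]_2) :
    {mpoly K[4]} :=
  \sum_(i < a.+1) \sum_(j < b.+1)
    (l 0 0 ^+ i * l 0 1 ^+ (a - i) * m 0 0 ^+ j * m 0 1 ^+ (b - j))
      *: bimonom K i (a - i) j (b - j).

(* [F] lies in the projective span of s points. The points need not be distinct,
   which does not affect the least s. *)
Definition in_span_of_points (K : fieldType) (a b : nat) (F : {mpoly K[4]})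
    (s : nat) : Prop :=
  F != 0 /\
  exists (l m : 'I_s -> 'rV[K]_2) (c : 'I_s -> K),
    (forall t, l t != 0 /\ m t != 0) /\
    F = \sum_(t < s) c t *: segre_veronese a b (l t) (m t).

Definition is_rank (K : fieldType) (a b : nat) (F : {mpoly K[4]}) (r : nat) :
    Prop :=
  [/\ (1 <= r)%N, in_span_of_points a b F r
    & forall s, (1 <= s)%N -> in_span_of_points a b F s -> (r <= s)%N].

(* Main.v *)
Require Import Defs.
From mathcomp Require Import all_boot all_order all_algebra.
From mathcomp Require Import reals.
From mathcomp Require Import complex.
From mathcomp Require Import mpoly.
From mathcomp Require Import boolp cyclic separable cyclotomic zify ring.

Set Implicit Arguments.
Unset Strict Implicit.
Unset Printing Implicit Defensive.

Import Order.TTheory GRing.Theory Num.Theory.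

Local Open Scope ring_scope.

(** By duality, F lies in the span of the points P_t exactly when the functional
    taking a form of bidegree (a, b) to its coefficient at the monomial of F is
    a linear combination of the evaluations at the P_t ([span_representsP]).

    Lower bounds.  If G vanishes at the points then so do its multiples, and the
    functional kills them; so G is apolar to F ([apolarity]).  A number of points
    is bounded below by the dimension of any space of forms restricted to it, so
    it suffices to show that few forms of a suitable bidegree vanish at
    the points.  Apolarity alone only yields (k1+1)(l1+1).  The gain comes from
    the points being reduced: if x1^e G vanishes at them with e > 0, so does
    x1 G, and apolarity may be applied to x1 G.  In bidegree (k0, l1) no
    nonzero form vanishes ([leq_points_strip]), which gives (k0+1)(l1+1), and
    (k1+1)(l0+1) after exchanging the two factors.  In bidegree (k1+1, l1+1) the
    vanishing forms are x1^(k1+1) q(y) + y1^(l1+1) p(x), and eliminating between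
    two of them shows that they are proportional ([leq_points_corner]), which
    gives (k1+2)(l1+2) - 1.

    Upper bound.  Take for the points a finite subgroup of the torus, i.e. the
    characters of Z^2 / L for a lattice L.  Orthogonality of characters puts F in
    their span as soon as L meets the box [-k0, k1] x [-l0, l1] only in 0.  The
    bound is the area of the L-shaped polygon made of the rectangles
    (k0+1) x (l1+1) and (k1+1) x (l0+1), which share (k1+1) x (l1+1).  The
    lattice spanned by (k0+1, l0-l1) and (k0-k1, l0+1) has this area as
    its index and avoids the box ([box_avoids_lattice],
    [represents_roots_of_unity]). *)

(** * Moments and binary forms *)

Definition bimon (K : fieldType) n m (x0 x1 y0 y1 : K) i j : K :=
  x0 ^+ (n - i) * x1 ^+ i * (y0 ^+ (m - j) * y1 ^+ j).

Definition biform (K : fieldType) (v : nat -> nat -> K) n m (x0 x1 y0 y1 : K) : K :=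
  \sum_(i < n.+1) \sum_(j < m.+1) v i j * bimon n m x0 x1 y0 y1 i j.

(** The monomial x0^k0 x1^k1 y0^l0 y1^l1 and a combination of points of the
    embedded surface agree exactly when this system of moment equations holds:
    the functional `coefficient of alpha0^k0 alpha1^k1 beta0^l0 beta1^l1' on
    forms of bidegree (k0 + k1, l0 + l1) is the combination with weights [c] of
    the evaluations at the points.  The index set is an arbitrary finite type
    because the points constructed for the upper bound form a product. *)
Definition represents (K : fieldType) k0 k1 l0 l1 (T : finType) (c x0 x1 y0 y1 : T -> K) : Prop :=
  forall i j, (i <= k0 + k1)%N -> (j <= l0 + l1)%N ->
    \sum_t c t * bimon (k0 + k1) (l0 + l1) (x0 t) (x1 t) (y0 t) (y1 t) i j
      = ((i == k1) && (j == l1))%:R.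

Lemma sum_ord_single (V : nmodType) n (F : nat -> V) k : (k <= n)%N ->
  (forall i, (i <= n)%N -> i != k -> F i = 0) -> \sum_(i < n.+1) F i = F k.
Proof.
move=> kn F0; rewrite (bigD1 (inord k)) //= inordK ?ltnS // big1 ?addr0 // => i nik.
by apply: F0; [rewrite -ltnS|apply: contraNN nik => /eqP <-; rewrite inord_val].
Qed.

Lemma biformC (K : fieldType) (v : nat -> nat -> K) n m x0 x1 y0 y1 :
  biform v n m x0 x1 y0 y1 = biform (fun j i => v i j) m n y0 y1 x0 x1.
Proof.
rewrite /biform exchange_big; apply: eq_bigr => j _; apply: eq_bigr => i _.
by rewrite /bimon [X in _ * X]mulrC.
Qed.

Lemma representsC (K : fieldType) k0 k1 l0 l1 (T : finType) (c x0 x1 y0 y1 : T -> K) :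
  represents k0 k1 l0 l1 c x0 x1 y0 y1 -> represents l0 l1 k0 k1 c y0 y1 x0 x1.
Proof.
move=> H j i lej lei; rewrite andbC -H //; apply: eq_bigr => t _.
by rewrite /bimon [X in _ * X]mulrC.
Qed.

(** The functional represented by the points kills every multiple of
    x1^e y1^f G, where G is the form with coefficients [v].  Take the multiple
    by the monomial that moves the term (i, j) to the distinguished exponent
    (k0, k1, l0, l1): the functional then reads off v i j.  The upper bounds on
    n, m, i + e and j + f say that this monomial has nonnegative exponents.
    Allowing e > 0 or f > 0 discards the points with x1 = 0 or y1 = 0, at the
    price of exponents of x1 or y1. *)
Lemma apolarity (K : fieldType) k0 k1 l0 l1 (T : finType) (c x0 x1 y0 y1 : T -> K)
    (v : nat -> nat -> K) e f n m i j :
  represents k0 k1 l0 l1 c x0 x1 y0 y1 ->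
  (forall t, x1 t ^+ e * y1 t ^+ f * biform v n m (x0 t) (x1 t) (y0 t) (y1 t) = 0) ->
  (i <= n <= i + k0)%N -> (j <= m <= j + l0)%N ->
  (i + e <= k1)%N -> (j + f <= l1)%N -> v i j = 0.
Proof.
move=> H G0 /andP[le_in le_n] /andP[le_jm le_m] le_ie le_jf.
pose h t := c t * (x0 t ^+ (k0 + i - n) * x1 t ^+ (k1 - e - i) *
                   (y0 t ^+ (l0 + j - m) * y1 t ^+ (l1 - f - j))).
have: \sum_t h t * (x1 t ^+ e * y1 t ^+ f * biform v n m (x0 t) (x1 t) (y0 t) (y1 t)) = 0.
  by apply: big1 => t _; rewrite G0 mulr0.
pose S i' j' := \sum_t c t * bimon (k0 + k1) (l0 + l1) (x0 t) (x1 t) (y0 t) (y1 t)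
   (i' + k1 - i) (j' + l1 - j).
have -> : \sum_t h t * (x1 t ^+ e * y1 t ^+ f * biform v n m (x0 t) (x1 t) (y0 t) (y1 t))
   = \sum_(i' < n.+1) \sum_(j' < m.+1) v i' j' * S i' j'.
  under eq_bigr => t _.
    rewrite /biform !mulr_sumr; under eq_bigr => i' _ do rewrite !mulr_sumr.
    over.
  rewrite exchange_big; apply: eq_bigr => i' _.
  rewrite exchange_big; apply: eq_bigr => j' _.
  rewrite mulr_sumr; apply: eq_bigr => t _; rewrite /h /bimon.
  have := ltn_ord i'; have := ltn_ord j'; rewrite !ltnS => lej' lei'.
  have -> : (k0 + k1 - (i' + k1 - i) = (k0 + i - n) + (n - i'))%N by lia.
  have -> : (l0 + l1 - (j' + l1 - j) = (l0 + j - m) + (m - j'))%N by lia.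
  have -> : (i' + k1 - i = (k1 - e - i) + e + i')%N by lia.
  have -> : (j' + l1 - j = (l1 - f - j) + f + j')%N by lia.
  rewrite !exprD; ring.
have SE i' j' : (i' <= n)%N -> (j' <= m)%N -> S i' j' = ((i' == i) && (j' == j))%:R.
  move=> lei' lej'; rewrite /S H; [|lia|lia].
  by congr ((_ && _)%:R); lia.
rewrite (@sum_ord_single _ _ (fun i' => \sum_(j' < m.+1) v i' j' * S i' j') i) //; last first.
  move=> i' lei' /negPf ni; apply: big1 => j' _.
  by rewrite SE ?ni ?mulr0 // -ltnS.
rewrite (@sum_ord_single _ _ (fun j' => v i j' * S i j') j) //; last first.
  by move=> j' lej' /negPf nj; rewrite SE // nj andbF mulr0.
by rewrite SE // !eqxx mulr1.
Qed.

Lemma exists_left_kernel (K : fieldType) (I J : finType) (E : I -> J -> K) :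
  (#|J| < #|I|)%N ->
  exists v : I -> K, (exists i, v i != 0) /\ forall j, \sum_i v i * E i j = 0.
Proof.
move=> ltJI; pose M := \matrix_(i < #|I|, j < #|J|) E (enum_val i) (enum_val j).
have : kermx M != 0.
  by rewrite kermx_eq0 -row_leq_rank -ltnNge; apply: leq_ltn_trans ltJI; apply: rank_leq_col.
case/rowV0Pn => w /sub_kermxP wM w0; exists (fun i => w 0 (enum_rank i)); split.
  by case/rV0Pn: w0 => i wi; exists (enum_val i); rewrite enum_valK.
move=> j; have := congr1 (fun A : 'rV_#|J| => A 0 (enum_rank j)) wM.
rewrite !mxE (reindex enum_rank) /=; last exact: onW_bij (enum_rank_bij I).
by move=> /(etrans _); apply; apply: eq_bigr => i _; rewrite !mxE !enum_rankK.
Qed.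

(** The conditions E _ _ t = 0 will be vanishing at the points, possibly together
    with one further linear condition on the coefficients. *)
Lemma exists_biform_kernel (K : fieldType) (J : finType) (E : nat -> nat -> J -> K) n m :
  (#|J| < n.+1 * m.+1)%N ->
  exists v : nat -> nat -> K,
    (exists i j, [/\ (i <= n)%N, (j <= m)%N & v i j != 0]) /\
    forall t, \sum_(i < n.+1) \sum_(j < m.+1) v i j * E i j t = 0.
Proof.
move=> ltJ; have [|v [[[i j] vij] v0]] :=
  @exists_left_kernel K ('I_n.+1 * 'I_m.+1)%type J (fun u t => E u.1 u.2 t).
  by rewrite card_prod !card_ord.
exists (fun i j => v (inord i, inord j)); split.
  by exists i, j; rewrite !inord_val !leq_ord.
move=> t; rewrite -[RHS](v0 t) pair_big /=; apply: eq_bigr => -[i' j'] _.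
by rewrite !inord_val.
Qed.

(** * The lower bounds *)

(** The forms of bidegree (k0, l1) are linearly independent on the points.  For
    a form vanishing on them, let p be the least exponent of x1 that occurs.
    Off the line x1 = 0 the factor x1^p can be cancelled, leaving a form
    of bidegree (k0 - p, l1) whose product with x1 vanishes at all the points;
    apolarity with e = 1 kills its coefficients of x1^0, which are
    the coefficients of x1^p in the original form.  Dividing by x1^p is what
    uses that the points are reduced, and gives k0 + 1 in place of the
    k1 + 1 obtained from ranks of catalecticants. *)
Lemma leq_points_strip (K : fieldType) k0 k1 l0 l1 (T : finType) (c x0 x1 y0 y1 : T -> K) :
  (1 <= k1)%N -> (l1 <= l0)%N -> represents k0 k1 l0 l1 c x0 x1 y0 y1 ->
  ((k0 + 1) * (l1 + 1) <= #|T|)%N.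
Proof.
move=> k1_gt0 le_l H; rewrite leqNgt; apply/negP => lt_s.
have [|v [[i0 [j0 [lei0 lej0 /negP vn0]]] v0]] := @exists_biform_kernel K T
  (fun i j t => bimon k0 l1 (x0 t) (x1 t) (y0 t) (y1 t) i j) k0 l1.
  by rewrite -(addn1 k0) -(addn1 l1).
apply: vn0; suff vz i : (i <= k0)%N -> forall j, (j <= l1)%N -> v i j = 0.
  by rewrite vz.
elim/ltn_ind: i {lei0} => p IH lep j lej.
pose w i j := v (p + i)%N j.
suff: w 0%N j = 0 by rewrite /w addn0.
apply: (@apolarity K k0 k1 l0 l1 T c x0 x1 y0 y1 w 1 0 (k0 - p) l1 0 j) => //; try lia.
move=> t; rewrite expr0 mulr1 expr1.
have [->|x1n] := eqVneq (x1 t) 0; first by rewrite mul0r.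
have : x1 t ^+ p * biform w (k0 - p) l1 (x0 t) (x1 t) (y0 t) (y1 t) = 0.
  rewrite -[RHS](v0 t) -[in RHS](big_mkord xpredT
    (fun i => \sum_(j' < l1.+1) v i j' * bimon k0 l1 (x0 t) (x1 t) (y0 t) (y1 t) i j')).
  rewrite (big_cat_nat (n := p)) //=; last by lia.
  rewrite [X in _ = X + _]big_nat [X in _ = X + _]big1 ?add0r; last first.
    move=> i /andP[_ ltip]; apply: big1 => j' _.
    by rewrite IH ?mul0r //; [lia|rewrite -ltnS].
  rewrite -[X in \big[_/_]_(X <= i < _) _]add0n big_addn subSn // big_mkord mulr_sumr.
  apply: eq_bigr => i _; rewrite mulr_sumr; apply: eq_bigr => j' _.
  rewrite /w /bimon addnC subnDA addnC exprD.
  by rewrite subnAC; ring.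
by move/eqP; rewrite mulf_eq0 expf_eq0 (negPf x1n) andbF => /eqP ->; rewrite mulr0.
Qed.

Lemma biform_last_column (K : fieldType) (v : nat -> nat -> K) n m (x0 x1 y0 y1 : K) :
  (forall i j, (i <= n)%N -> (j < m)%N -> v i j = 0) ->
  biform v n m x0 x1 y0 y1 = y1 ^+ m * biform (fun i _ => v i m) n 0 x0 x1 y0 y1.
Proof.
move=> v0; rewrite /biform mulr_sumr; apply: eq_bigr => i _.
rewrite (@sum_ord_single _ _ (fun j => v i j * bimon n m x0 x1 y0 y1 i j) m) //.
  by rewrite big_ord1 /bimon subnn sub0n !expr0; ring.
by move=> j lej nj; rewrite v0 ?mul0r ?ltn_neqAle ?nj // leq_ord.
Qed.

(** With only its last column left the form is y1^(l1+1) p(x0, x1), so y1 p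
    vanishes at the points, these being reduced.  Apolarity with f = 1 reduces p
    to its term in x1^(k1+1).  If that term were nonzero, x1 y1 would vanish at
    all the points, which apolarity with e = f = 1 excludes. *)
Lemma biform_last_column_eq0 (K : fieldType) k0 k1 l0 l1 (T : finType) (c x0 x1 y0 y1 : T -> K) v :
  (1 <= k1 < k0)%N -> (1 <= l1 < l0)%N -> represents k0 k1 l0 l1 c x0 x1 y0 y1 ->
  (forall t, biform v k1.+1 l1.+1 (x0 t) (x1 t) (y0 t) (y1 t) = 0) ->
  (forall i j, (i <= k1.+1)%N -> (j <= l1)%N -> v i j = 0) ->
  forall i j, (i <= k1.+1)%N -> (j <= l1.+1)%N -> v i j = 0.
Proof.
move=> /andP[k1_gt0 ltk] /andP[l1_gt0 ltl] H G0 v0.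
have red (z a : K) n : z ^+ n.+1 * a = 0 -> z * a = 0.
  by move/eqP; rewrite mulf_eq0 expf_eq0 /= => /orP[] /eqP ->; rewrite ?mul0r ?mulr0.
have G1 t : y1 t * biform (fun i _ => v i l1.+1) k1.+1 0 (x0 t) (x1 t) (y0 t) (y1 t) = 0.
  by apply: (red _ _ l1); rewrite -biform_last_column.
have v1 i : (i <= k1)%N -> v i l1.+1 = 0.
  move=> lei; apply: (@apolarity K k0 k1 l0 l1 T c x0 x1 y0 y1 (fun i _ => v i l1.+1)
    0 1 k1.+1 0 i 0) => //; try lia.
  by move=> t; rewrite expr0 mul1r expr1 G1.
have vc : v k1.+1 l1.+1 = 0.
  apply: (@apolarity K k0 k1 l0 l1 T c x0 x1 y0 y1 (fun _ _ => v k1.+1 l1.+1)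
    1 1 0 0 0 0) => //; try lia.
  move=> t; rewrite !expr1 -mulrA; apply: (red _ _ k1).
  rewrite mulrCA -[RHS](G1 t); congr (_ * _).
  rewrite [RHS]biformC [RHS]biform_last_column; last by move=> j i _ lei; apply: v1.
  by congr (_ * _); rewrite biformC.
move=> i j lei; rewrite leq_eqVlt => /orP[/eqP->|].
  by move: lei; rewrite leq_eqVlt => /orP[/eqP->|/v1].
by rewrite ltnS; apply: v0.
Qed.

Definition binary_form (K : fieldType) (a : nat -> K) n (x0 x1 : K) : K :=
  \sum_(i < n.+1) a i * (x0 ^+ (n - i) * x1 ^+ i).

Lemma mul_binary_form (K : fieldType) (a b : nat -> K) n m (x0 x1 y0 y1 : K) :
  binary_form a n x0 x1 * binary_form b m y0 y1
    = biform (fun i j => a i * b j) n m x0 x1 y0 y1.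
Proof.
rewrite /binary_form /biform mulr_suml; apply: eq_bigr => i _.
by rewrite mulr_sumr; apply: eq_bigr => j _; rewrite /bimon mulrACA.
Qed.

Lemma biformB (K : fieldType) (v w : nat -> nat -> K) n m (x0 x1 y0 y1 : K) :
  biform (fun i j => v i j - w i j) n m x0 x1 y0 y1
    = biform v n m x0 x1 y0 y1 - biform w n m x0 x1 y0 y1.
Proof.
rewrite /biform -sumrB; apply: eq_bigr => i _; rewrite -sumrB.
by apply: eq_bigr => j _; rewrite mulrBl.
Qed.

(** The coefficient of x1^n y1^m belongs to both the last row and the last
    column; it is assigned to the first summand, whence the conditional in the
    second. *)
Lemma biform_split (K : fieldType) (v : nat -> nat -> K) n m (x0 x1 y0 y1 : K) :
  (forall i j, (i < n)%N -> (j < m)%N -> v i j = 0) ->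
  biform v n m x0 x1 y0 y1 = x1 ^+ n * binary_form (v n) m y0 y1
    + y1 ^+ m * binary_form (fun i => if i == n then 0 else v i m) n x0 x1.
Proof.
move=> v0; rewrite /biform /binary_form big_ord_recr /= addrC; congr (_ + _).
  by rewrite mulr_sumr; apply: eq_bigr => j _; rewrite /bimon subnn expr0; ring.
rewrite big_ord_recr /= eqxx mul0r addr0 mulr_sumr; apply: eq_bigr => i _.
rewrite (ltn_eqF (ltn_ord i)).
rewrite (@sum_ord_single _ _ (fun j => v i j * bimon n m x0 x1 y0 y1 i j) m) //.
  by rewrite /bimon subnn expr0; ring.
by move=> j lej nj; rewrite v0 ?mul0r // ltn_neqAle nj.
Qed.

(** At most one form of bidegree (k1+1, l1+1), up to scalars, vanishes at the
    points.  Apolarity shows that such a form is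
    G_v = x1^(k1+1) q_v(y) + y1^(l1+1) p_v(x).  For two of them,
    x1^(k1+1) (p_v q_w - p_w q_v) vanishes at the points, hence so does
    x1 (p_v q_w - p_w q_v), and apolarity yields relations between the
    coefficients of p_v, p_w, q_v, q_w.  If the solutions had dimension at least
    two, G_v could be chosen without its term in x1^k1 y1^(l1+1), and then G_w
    without its term in x1^i y1^(l1+1), for some i < k1 where p_v has a nonzero
    coefficient; the relations then force q_w = 0 up to its coefficient of
    y1^(l1+1), so G_w = 0. *)
Lemma leq_points_corner (K : fieldType) k0 k1 l0 l1 (T : finType) (c x0 x1 y0 y1 : T -> K) :
  (1 <= k1 < k0)%N -> (1 <= l1 < l0)%N -> represents k0 k1 l0 l1 c x0 x1 y0 y1 ->
  ((k1 + 2) * (l1 + 2) - 1 <= #|T|)%N.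
Proof.
move=> hk hl H; rewrite leqNgt; apply/negP => lt_s.
have /andP[k1_gt0 ltk] := hk; have /andP[l1_gt0 ltl] := hl.
pose vanish v := forall t, biform v k1.+1 l1.+1 (x0 t) (x1 t) (y0 t) (y1 t) = 0.
have exv p : (p <= k1)%N -> exists v : nat -> nat -> K,
    [/\ exists i j, [/\ (i <= k1.+1)%N, (j <= l1.+1)%N & v i j != 0], vanish v
      & v p l1.+1 = 0].
  move=> lep; have [|v [vn0 v0]] := @exists_biform_kernel K (option T)
    (fun i j o => if o is Some t then bimon k1.+1 l1.+1 (x0 t) (x1 t) (y0 t) (y1 t) i j
       else ((i == p) && (j == l1.+1))%:R) k1.+1 l1.+1.
    by rewrite card_option; lia.
  exists v; split=> [//|t|]; first exact: (v0 (Some t)).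
  have := v0 None; rewrite (@sum_ord_single _ _ (fun i => \sum_(j < l1.+2)
    v i j * ((i == p) && (j == l1.+1 :> nat))%:R) p) => [||i _ /negPf ni].
  - rewrite (@sum_ord_single _ _ (fun j => v p j * ((p == p) && (j == l1.+1))%:R) l1.+1) //.
      by rewrite !eqxx mulr1.
    by move=> j _ /negPf nj; rewrite nj andbF mulr0.
  - lia.
  - by apply: big1 => j _; rewrite ni mulr0.
(* Membership in the ideal generated by x1^(k1+1) and y1^(l1+1); this is where
   k1 < k0 and l1 < l0 matter, since otherwise x0^(k1+1) or y0^(l1+1) also
   annihilates the monomial. *)
have low v : vanish v -> forall i j, (i <= k1)%N -> (j <= l1)%N -> v i j = 0.
  move=> G0 i j lei lej.
  apply: (@apolarity K k0 k1 l0 l1 T c x0 x1 y0 y1 v 0 0 k1.+1 l1.+1 i j) => //; try lia.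
  by move=> t; rewrite G0 mulr0.
have q_determines v : vanish v -> (forall j, (j <= l1)%N -> v k1.+1 j = 0) ->
    forall i j, (i <= k1.+1)%N -> (j <= l1.+1)%N -> v i j = 0.
  move=> G0 vj; apply: (biform_last_column_eq0 hk hl H G0) => i j.
  by rewrite leq_eqVlt => /orP[/eqP->|lei] lej; [apply: vj|apply: low].
have p_determines v : vanish v -> (forall i, (i <= k1)%N -> v i l1.+1 = 0) ->
    forall i j, (i <= k1.+1)%N -> (j <= l1.+1)%N -> v i j = 0.
  move=> G0 vi i j lei lej.
  apply: (biform_last_column_eq0 hl hk (representsC H) (v := fun j i => v i j)) => // [t|j' i'].
    by rewrite -biformC.
  by rewrite leq_eqVlt => /orP[/eqP->|lei'] lej'; [apply: vi|apply: low].
have [v [[i0 [j0 [lei0 lej0 vn0]]] Gv vk1]] := exv k1 (leqnn _).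
have [p ltp vp] : exists2 p, (p < k1)%N & v p l1.+1 != 0.
  have [/existsP[p vp]|] := boolP [exists p : 'I_k1, v p l1.+1 != 0]; first by exists p.
  move/existsPn => vp; case/eqP: vn0; apply: p_determines => // i.
  rewrite leq_eqVlt => /orP[/eqP->//|lti].
  by have := vp (Ordinal lti); rewrite negbK => /eqP.
have [w [[i1 [j1 [lei1 lej1 wn0]]] Gw wp]] := exv p (ltnW ltp).
case/eqP: wn0; apply: q_determines => // j lej.
pose P z i : K := if i == k1.+1 then 0 else z i l1.+1.
pose pt z t := binary_form (P z) k1.+1 (x0 t) (x1 t).
pose qt z t := binary_form (z k1.+1) l1.+1 (y0 t) (y1 t).
have split z t : vanish z -> x1 t ^+ k1.+1 * qt z t = - (y1 t ^+ l1.+1 * pt z t).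
  by move=> Gz; apply/eqP; rewrite -addr_eq0 -biform_split ?Gz //; apply: low.
have : P v p * w k1.+1 j - P w p * v k1.+1 j = 0.
  apply: (@apolarity K k0 k1 l0 l1 T c x0 x1 y0 y1
    (fun i j => P v i * w k1.+1 j - P w i * v k1.+1 j) 1 0 k1.+1 l1.+1 p j) => //; try lia.
  move=> t; rewrite expr1 expr0 mulr1 biformB -!mul_binary_form.
  rewrite -/(pt v t) -/(pt w t) -/(qt v t) -/(qt w t).
  have : x1 t ^+ k1.+1 * (pt v t * qt w t - pt w t * qt v t) = 0.
    by rewrite mulrBr ![_ ^+ _ * (_ * _)]mulrCA !split //; ring.
  by move/eqP; rewrite mulf_eq0 expf_eq0 /= => /orP[] /eqP ->; rewrite ?mul0r ?mulr0.
rewrite /P ltn_eqF 1?ltnW // wp mul0r subr0 => /eqP.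
by rewrite mulf_eq0 (negPf vp) => /eqP.
Qed.

(** * The upper bound *)

Lemma prim_root_exists (C : numClosedFieldType) n :
  (0 < n)%N -> exists z : C, n.-primitive_root z.
Proof.
move=> n_gt0; pose p : {poly C} := 'X^n - 1.
have [r Dp] := closed_field_poly_normal p.
rewrite (monicP _) ?monicXnsubC // scale1r in Dp.
have rn1: all n.-unity_root r by apply/allP=> z; rewrite -root_prod_XsubC -Dp.
have sz_r: (n <= size r)%N.
  by rewrite -ltnS -(size_prod_XsubC r id) -Dp size_XnsubC.
have [|z] := hasP (has_prim_root n_gt0 rn1 _ sz_r); last by exists z.
by rewrite -separable_prod_XsubC -Dp separable_Xn_sub_1 // pnatr_eq0 -lt0n.
Qed.

Lemma prim_exprz_eq1 (K : fieldType) n (z : K) (A : int) :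
  n.-primitive_root z -> (z ^ A == 1) = (n%:Z %| A)%Z.
Proof.
move=> zn; rewrite dvdzE (prim_order_dvd zn).
by case: A => m //=; rewrite /exprz invr_eq1.
Qed.

Lemma sum_expr_unity (K : fieldType) n (z : K) :
  z ^+ n = 1 -> \sum_(u < n) z ^+ u = if z == 1 then n%:R else 0.
Proof.
case: eqP => [->|/eqP z1] zn.
  by under eq_bigr do rewrite expr1n; rewrite sumr_const card_ord.
apply/eqP; have := subrX1 z n; rewrite zn subrr => /esym/eqP.
by rewrite mulf_eq0 subr_eq0 (negPf z1).
Qed.

(** The lattice spanned by (k0+1, l0-l1) and (k0-k1, l0+1) meets the box
    [-k0, k1] x [-l0, l1] only in 0.  When m and n are both >= 0 or both <= 0, one
    coordinate exceeds k0 or l0 in absolute value; when they have opposite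
    signs, the sign of m + n decides which side of the box the vector leaves
    through. *)
Lemma box_avoids_lattice (k0 k1 l0 l1 : nat) (i j m n : int) :
  (k1 <= k0)%N -> (l1 <= l0)%N ->
  - k0%:Z <= i <= k1%:Z -> - l0%:Z <= j <= l1%:Z ->
  i = (k0%:Z + 1) * m + (k0%:Z - k1%:Z) * n ->
  j = (l0%:Z - l1%:Z) * m + (l0%:Z + 1) * n ->
  i = 0 /\ j = 0.
Proof.
move=> hk hl /andP[i1 i2] /andP[j1 j2] Ei Ej.
(* In this form both terms of i (or both terms of j) have the same sign once the
   sign of m + n is known, when m and n have opposite signs. *)
have Ei' : i = (k1%:Z + 1) * m + (k0%:Z - k1%:Z) * (m + n) by rewrite Ei; ring.
have Ej' : j = (l1%:Z + 1) * n + (l0%:Z - l1%:Z) * (m + n) by rewrite Ej; ring.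
have [d0 e0] : 0 <= k0%:Z - k1%:Z /\ 0 <= l0%:Z - l1%:Z by lia.
move: d0 e0 Ei Ej Ei' Ej'; set d := k0%:Z - k1%:Z; set e := l0%:Z - l1%:Z => d0 e0 Ei Ej Ei' Ej'.
have [m1|m1] := lerP 1 m.
  have [n0|n0] := lerP 0 n; first by nia.
  by have [s0|s0] := lerP 0 (m + n); nia.
have [mn1|mn1] := lerP m (-1).
  have [n0|n0] := lerP n 0; first by nia.
  by have [s0|s0] := lerP 0 (m + n); nia.
have m0 : m = 0 by lia.
have [n1|n1] := lerP 1 n; first by nia.
have [nn1|nn1] := lerP n (-1); first by nia.
have n0 : n = 0 by lia.
by rewrite Ei Ej m0 n0 !mulr0.
Qed.

(** Sampling at the finite group of characters of Z^2 / L, for L the lattice of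
    the previous lemma.  By orthogonality the average over this group of
    the monomials, twisted by the inverse of the distinguished one, detects the
    exponents congruent to (k0, l0) modulo L, and within bidegree
    (k0 + k1, l0 + l1) there is no other such exponent.  The index of L is
    N = (k0+1)(l0+1) - (k0-k1)(l0-l1), which is the bound.

    Every character takes N-th roots of unity as values, and the characters are
    the pairs (z^P, z^Q) with (P, Q) running modulo N over the image of
    the adjugate of the matrix of generators of L.  The group need not be cyclic; a Hermite normal form
    gives the fundamental domain g x N/g for the parameters, where g is the gcd
    of k0+1 and l0-l1. *)
Lemma represents_roots_of_unity (K : fieldType) (k0 k1 l0 l1 N : nat) (z : K) :
  (k1 <= k0)%N -> (l1 <= l0)%N ->
  N = ((k0 + 1) * (l1 + 1) + (k1 + 1) * (l0 + 1) - (k1 + 1) * (l1 + 1))%N ->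
  N.-primitive_root z ->
  exists T : finType, exists c x0 y0 : T -> K,
    #|T| = N /\ represents k0 k1 l0 l1 c x0 (fun _ => 1) y0 (fun _ => 1).
Proof.
move=> hk hl EN zN.
pose d := (k0 - k1)%N; pose e := (l0 - l1)%N.
have ENz : N%:Z = (k0%:Z + 1) * (l0%:Z + 1) - d%:Z * e%:Z.
  by rewrite EN /d /e; nia.
pose g := gcdn (k0 + 1) e.
have g_gt0 : (0 < g)%N by rewrite gcdn_gt0 addn1.
have /dvdnP[p Ep] : (g %| k0 + 1)%N by apply: dvdn_gcdl.
have /dvdnP[q Eq] : (g %| e)%N by apply: dvdn_gcdr.
have /dvdnP[h Nh] : (g %| N)%N.
  suff : (g%:Z %| N%:Z)%Z by [].
  by apply/dvdzP; exists (p%:Z * (l0%:Z + 1) - d%:Z * q%:Z); rewrite ENz; nia.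
have z0 : z != 0 by rewrite (prim_root_eq0 zN); move: (prim_order_gt0 zN); lia.
have N0 : N%:R != 0 :> K by apply: (prim_root_natf_neq0 zN).
pose P (t : 'I_g * 'I_h) : int := (l0%:Z + 1) * t.1%:Z - e%:Z * t.2%:Z.
pose Q (t : 'I_g * 'I_h) : int := (k0%:Z + 1) * t.2%:Z - d%:Z * t.1%:Z.
exists ('I_g * 'I_h)%type,
  (fun t => N%:R^-1 * z ^ (- (k0%:Z * P t + l0%:Z * Q t))),
  (fun t => z ^ P t), (fun t => z ^ Q t); split.
  by rewrite card_prod !card_ord Nh mulnC.
move=> i j lei lej.
(* The exponent of x0 in the term indexed by i is k0 + k1 - i = k0 + di, so
   (di, dj) is the displacement from the distinguished exponent; in terms of it
   the sum factors into two geometric sums. *)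
pose di := k1%:Z - i%:Z; pose dj := l1%:Z - j%:Z.
pose A := (l0%:Z + 1) * di - d%:Z * dj.
pose B := (k0%:Z + 1) * dj - e%:Z * di.
have -> : \sum_(t : 'I_g * 'I_h) N%:R^-1 * z ^ (- (k0%:Z * P t + l0%:Z * Q t)) *
    bimon (k0 + k1) (l0 + l1) (z ^ P t) 1 (z ^ Q t) 1 i j
  = N%:R^-1 * ((\sum_(u < g) (z ^ A) ^+ u) * (\sum_(v < h) (z ^ B) ^+ v)).
  rewrite mulr_suml mulr_sumr.
  under [RHS]eq_bigr => u _ do rewrite mulr_sumr mulr_sumr.
  rewrite pair_big /=; apply: eq_bigr => t _.
  rewrite -mulrA; congr (_ * _).
  rewrite /bimon !expr1n !mulr1 !exprnP !exprz_exp -!expfzDr //; congr (_ ^ _).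
  rewrite /A /B /P /Q /di /dj -!subzn //; ring.
(* If N divides A and B, these two identities exhibit (di, dj) as a vector of
   the lattice. *)
have EA : (k0%:Z + 1) * A + d%:Z * B = N%:Z * di by rewrite ENz /A /B; ring.
have EB : e%:Z * A + (l0%:Z + 1) * B = N%:Z * dj by rewrite ENz /A /B; ring.
have zB : (z ^ B) ^+ h = 1.
  apply/eqP; rewrite exprnP exprz_exp (prim_exprz_eq1 _ zN).
  apply/dvdzP; exists (p%:Z * dj - q%:Z * di); rewrite Nh /B Eq !PoszM.
  have -> : k0%:Z + 1 = p%:Z * g%:Z by rewrite -PoszM -Ep PoszD.
  ring.
have diag0 : (i == k1) && (j == l1) -> A = 0 /\ B = 0.
  by rewrite /A /B /di /dj => /andP[/eqP -> /eqP ->]; split; ring.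
rewrite (sum_expr_unity zB); case: ifPn => [|B1]; last first.
  rewrite !mulr0; case: (boolP (_ && _)) => // /diag0[_ B0].
  by rewrite B0 expr0z eqxx in B1.
rewrite (prim_exprz_eq1 _ zN) => /dvdzP[n Bn].
have zA : (z ^ A) ^+ g = 1.
  apply/eqP; rewrite exprnP exprz_exp (prim_exprz_eq1 _ zN).
  have [u [v]] := Bezoutz (k0%:Z + 1) e%:Z.
  have -> : gcdz (k0%:Z + 1) e%:Z = g%:Z by [].
  move=> <-; apply/dvdzP; exists (u * (di - d%:Z * n) + v * (dj - (l0%:Z + 1) * n)).
  have EA' : (k0%:Z + 1) * A = N%:Z * di - d%:Z * B by rewrite -EA; ring.
  have EB' : e%:Z * A = N%:Z * dj - (l0%:Z + 1) * B by rewrite -EB; ring.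
  transitivity (u * ((k0%:Z + 1) * A) + v * (e%:Z * A)); first by ring.
  by rewrite EA' EB' Bn; ring.
rewrite (sum_expr_unity zA); case: ifPn => [|A1]; last first.
  rewrite mul0r mulr0; case: (boolP (_ && _)) => // /diag0[A0 _].
  by rewrite A0 expr0z eqxx in A1.
rewrite (prim_exprz_eq1 _ zN) => /dvdzP[m Am].
have NZ0 : N%:Z != 0 by apply: contraNneq N0 => -[->].
have Ed : d%:Z = k0%:Z - k1%:Z by rewrite subzn.
have Ee : e%:Z = l0%:Z - l1%:Z by rewrite subzn.
have [||||di0 dj0] := @box_avoids_lattice k0 k1 l0 l1 di dj m n hk hl.
- by rewrite /di; lia.
- by rewrite /dj; lia.
- by apply: (mulfI NZ0); rewrite -EA Am Bn -Ed; ring.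
- by apply: (mulfI NZ0); rewrite -EB Am Bn -Ee; ring.
have -> : i = k1 by move: di0; rewrite /di; lia.
have -> : j = l1 by move: dj0; rewrite /dj; lia.
by rewrite !eqxx -natrM mulnC -Nh mulVf.
Qed.

(** * From moment equations to spans of points *)

(** The sum over exponents of x0 and y0 is turned around so that the summation
    index is the exponent of x1 and y1. *)
Lemma segre_veroneseE (K : fieldType) a b (l m : 'rV[K]_2) :
  segre_veronese a b l m = \sum_(i < a.+1) \sum_(j < b.+1)
    bimon a b (l 0 0) (l 0 1) (m 0 0) (m 0 1) i j *: bimonom K (a - i) i (b - j) j.
Proof.
rewrite /segre_veronese (reindex_inj rev_ord_inj); apply: eq_bigr => i _.
rewrite (reindex_inj rev_ord_inj); apply: eq_bigr => j _ /=.
by rewrite !subSS !subKn -1?ltnS // /bimon mulrA.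
Qed.

Definition mnm4 p q r s : 'X_{1..4} := [multinom nth 0%N [:: p; q; r; s] i | i < 4].

Lemma bimonomE (K : fieldType) p q r s : bimonom K p q r s = 'X_[mnm4 p q r s].
Proof.
rewrite /bimonom !mpolyXn -!mpolyXD; congr 'X_[_]; apply/mnmP => i.
rewrite !mnmE !mulmnE !mnm1E -!val_eqE /= !inordK //.
by case: i => [[|[|[|[|//]]]] ?] /=; lia.
Qed.

Lemma mcoeff_bimonom (K : fieldType) a b i j i' j' :
  (bimonom K (a - i) i (b - j) j)@_(mnm4 (a - i') i' (b - j') j')
    = ((i == i') && (j == j'))%:R.
Proof.
rewrite bimonomE mcoeffX; congr ((nat_of_bool _)%:R); apply/eqP/andP=> [E|[/eqP-> /eqP->]] //.
have := congr1 (fun m : 'X_{1..4} => (m (inord 1), m (inord 3))) E.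
by rewrite !mnmE !inordK //= => -[-> ->]; rewrite !eqxx.
Qed.

(** Compare the coefficients of each monomial of bidegree (k0 + k1, l0 + l1). *)
Lemma span_representsP (K : fieldType) k0 k1 l0 l1 s (c : 'I_s -> K) (l m : 'I_s -> 'rV[K]_2) :
  bimonom K k0 k1 l0 l1 = \sum_t c t *: segre_veronese (k0 + k1) (l0 + l1) (l t) (m t)
  <-> represents k0 k1 l0 l1 c (fun t => l t 0 0) (fun t => l t 0 1)
        (fun t => m t 0 0) (fun t => m t 0 1).
Proof.
set S := \sum_t _.
pose M i j := \sum_t c t * bimon (k0 + k1) (l0 + l1) (l t 0 0) (l t 0 1) (m t 0 0) (m t 0 1) i j.
have SE : S = \sum_(i < (k0 + k1).+1) \sum_(j < (l0 + l1).+1)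
    M i j *: bimonom K (k0 + k1 - i) i (l0 + l1 - j) j.
  rewrite /S; under eq_bigr => t _.
    rewrite segre_veroneseE scaler_sumr.
    under eq_bigr => i _ do rewrite scaler_sumr.
    over.
  rewrite exchange_big; apply: eq_bigr => i _; rewrite exchange_big; apply: eq_bigr => j _.
  by rewrite scaler_suml; apply: eq_bigr => t _; rewrite scalerA.
have ES (A : nat -> nat -> K) i j : (i <= k0 + k1)%N -> (j <= l0 + l1)%N ->
   (\sum_(i < (k0 + k1).+1) \sum_(j < (l0 + l1).+1)
     A i j *: bimonom K (k0 + k1 - i) i (l0 + l1 - j) j)
     @_(mnm4 (k0 + k1 - i) i (l0 + l1 - j) j) = A i j.
  move=> lei lej; rewrite raddf_sum /=.
  under eq_bigr => i' _.
    rewrite raddf_sum /=; under eq_bigr => j' _ do rewrite mcoeffZ mcoeff_bimonom.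
    over.
  rewrite (@sum_ord_single _ _ (fun i' => \sum_(j' < (l0 + l1).+1)
    A i' j' * ((i' == i) && (j' == j :> nat))%:R) i) => [||i' _ /negPf ni] //.
    rewrite (@sum_ord_single _ _ (fun j' => A i j' * ((i == i) && (j' == j))%:R) j) //.
      by rewrite !eqxx mulr1.
    by move=> j' _ /negPf nj; rewrite nj andbF mulr0.
  by apply: big1 => j' _; rewrite ni mulr0.
have FE : bimonom K k0 k1 l0 l1 = bimonom K (k0 + k1 - k1) k1 (l0 + l1 - l1) l1.
  by rewrite !addnK.
split=> [F i j lei lej|H].
  have := ES M i j lei lej; rewrite -SE -F FE mcoeff_bimonom /M => <-.
  by rewrite (eq_sym k1) (eq_sym l1).
rewrite SE FE.
rewrite (@sum_ord_single _ _ (fun i => \sum_(j < (l0 + l1).+1)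
   M i j *: bimonom K (k0 + k1 - i) i (l0 + l1 - j) j) k1) ?leq_addl // => [|i lei /negPf ni].
  rewrite (@sum_ord_single _ _ (fun j => M k1 j *: bimonom K (k0 + k1 - k1) k1 (l0 + l1 - j) j) l1)
    ?leq_addl // => [|j lej /negPf nj].
    by rewrite /M H ?leq_addl // !eqxx scale1r.
  by rewrite /M H ?leq_addl // nj andbF scale0r.
by apply: big1 => j _; rewrite /M H -1?ltnS // ni scale0r.
Qed.

Lemma bimonom_neq0 (K : fieldType) p q r s : bimonom K p q r s != 0.
Proof. by rewrite bimonomE -msize_poly_eq0 msizeX. Qed.

Lemma in_span_of_roots_of_unity (C : numClosedFieldType) (k0 k1 l0 l1 : nat) :
  (k1 <= k0)%N -> (l1 <= l0)%N ->
  in_span_of_points (k0 + k1) (l0 + l1) (bimonom C k0 k1 l0 l1)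
    ((k0 + 1) * (l1 + 1) + (k1 + 1) * (l0 + 1) - (k1 + 1) * (l1 + 1)).
Proof.
move=> hk hl; set N := (_ - _)%N.
have [|z zN] := @prim_root_exists C N; first by rewrite /N; nia.
have [T [c [x [y [<- H]]]]] := represents_roots_of_unity hk hl (erefl N) zN.
split; first exact: bimonom_neq0.
pose r u : 'rV[C]_2 := \row_i (if i == 0 then u else 1).
have r1 u : r u 0 1 = 1 by rewrite mxE.
have r0 u : r u 0 0 = u by rewrite mxE.
have rn u : r u != 0.
  by apply/eqP => /rowP/(_ 1); rewrite r1 mxE => /eqP; rewrite oner_eq0.
exists (fun t => r (x (enum_val t))), (fun t => r (y (enum_val t))), (fun t => c (enum_val t)).
split=> //; apply/span_representsP => i j lei lej.
rewrite -[RHS](H i j lei lej) [RHS](reindex (@enum_val T T)) /=; last first.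
  exact/onW_bij/enum_val_bij.
by apply: eq_bigr => t _; rewrite !r0 !r1.
Qed.

Theorem theorem1p5 (R : realType) (k0 k1 l0 l1 : nat)
    (hk : (k1 <= k0)%N) (hk1 : (1 <= k1)%N)
    (hl : (l1 <= l0)%N) (hl1 : (1 <= l1)%N) :
  exists r : nat,
    is_rank (k0 + k1) (l0 + l1) (bimonom (complex R) k0 k1 l0 l1) r /\
    (r <= (k0 + 1) * (l1 + 1) + (k1 + 1) * (l0 + 1) - (k1 + 1) * (l1 + 1))%N /\
    (((k1 < k0)%N -> ((k0 + 1) * (l1 + 1) <= r)%N) /\
     ((l1 < l0)%N -> ((k1 + 1) * (l0 + 1) <= r)%N)) /\
    ((k1 < k0)%N -> (l1 < l0)%N -> ((k1 + 2) * (l1 + 2) - 1 <= r)%N).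
Proof.
have upper := in_span_of_roots_of_unity (complex R) hk hl.
pose spans s := `[< in_span_of_points (k0 + k1) (l0 + l1) (bimonom (complex R) k0 k1 l0 l1) s >].
have ex_spans : exists s, spans s by eexists; apply/asboolP; exact: upper.
have [r /asboolP rs r_min] := ex_minnP ex_spans.
have [_ [l [m [c [_ /span_representsP H]]]]] := rs.
have strip := leq_points_strip hk1 hl H; rewrite card_ord in strip.
exists r; split; [split=> //|split; [|split; [split|]]].
- by apply: leq_trans strip; rewrite muln_gt0 !addn1.
- by move=> s _ ss; apply: r_min; apply/asboolP.
- by apply: r_min; apply/asboolP.
- by [].
- by move=> _; move: (leq_points_strip hl1 hk (representsC H)); rewrite card_ord mulnC.
- move=> ltk ltl; have := leq_points_corner _ _ H.
  by rewrite card_ord hk1 ltk hl1 ltl; apply.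
Qed.
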